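(* Let $G$ be a finite simple graph in which every vertex has degree at most $3$. Then for every maximal packing $S$ of $G$, there exists an independent dominating set of $G$ of size at most $3|S|$.
   Context: A set $A\subseteq V(G)$ is a dominating set of $G$ if every vertex of $G$ is in $A$ or adjacent to a vertex of $A$; an independent dominating set is a dominating set no two of whose vertices are adjacent. A packing of $G$ is a set $S\subseteq V(G)$ whose closed neighborhoods $N_G[v]=N_G(v)\cup\{v\}$, $v\in S$, are pairwise disjoint (equivalently, any two distinct vertices of $S$ are at distance at least $3$ in $G$). A maximal packing is a packing not properly contained in any other packing of $G$. *)

(* Defs.v *)
From mathcomp Require Import all_boot.

Set Implicit Arguments.
Unset Strict Implicit.
Unset Printing Implicit Defensive.

Section Graph.

Variables (V : finType) (e : rel V).

Definition simple_graph : Prop := symmetric e /\ irreflexive e.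

Definition nbhd (v : V) : {set V} := [set w | e v w].

Definition cl_nbhd (v : V) : {set V} := v |: nbhd v.

Definition degree (v : V) : nat := #|nbhd v|.

Definition dominating (A : {set V}) : bool :=
  [forall v, (v \in A) || [exists u in A, e v u]].

Definition independent (A : {set V}) : bool :=
  [forall u in A, forall v in A, ~~ e u v].

Definition packing (S : {set V}) : bool :=
  [forall u in S, forall v in S,
    (u != v) ==> [disjoint cl_nbhd u & cl_nbhd v]].

Definition maximal_packing (S : {set V}) : bool := maxset packing S.

End Graph.

(* Main.v *)
Require Import Defs.
From mathcomp Require Import all_boot.

Set Implicit Arguments.
Unset Strict Implicit.
Unset Printing Implicit Defensive.

(** Let [X] be the open neighbourhood of [S] and [R] the set of the vertices
    outside [S] and [X]; by maximality each of them has a neighbour in [X].  So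
    the vertices of [S] and the stars [{x} + (N(x) & R)], [x] in [X], cover the
    graph.  Let [A] be a maximal independent set such that every [x] in [X] but
    not in [A] has a neighbour in [A & X].  As such an [x] also has a neighbour
    in [S], it has at most one in [A & R]; hence [A] meets every star at most
    once.  The region of [s], made of [s] and of the stars around [N(s)],
    therefore contains at most three vertices of [A], except perhaps if [s] is
    in [A] and two vertices of [N(s)] have a neighbour in [R].  The vertices of
    [X] with a neighbour in [R] induce a matching, as each of them also has a
    neighbour in [S]; so some independent subset of [X] meets [N(s)] for every
    [s] of the latter kind, and starting the construction of [A] from it keeps
    all these [s] out of [A]. *)

Lemma leq_card_bigcup (I V : finType) (P : pred I) (B : I -> {set V}) :
  #|\bigcup_(i | P i) B i| <= \sum_(i | P i) #|B i|.
Proof.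
apply: (big_rec2 (fun (A : {set V}) n => #|A| <= n)) => [|i n A _ leAn].
  by rewrite cards0.
by apply: leq_trans (leq_card_setU _ _) _; rewrite leq_add2l.
Qed.

Section SetFamilies.

Variables I V : finType.
Implicit Types (D : {set I}) (B : I -> {set V}).

Lemma bigcupSS D D' B B' :
    D' \subset D -> (forall i, B' i \subset B i) ->
  \bigcup_(i in D') B' i \subset \bigcup_(i in D) B i.
Proof.
move=> /subsetP sD sB; apply/bigcupsP => i /sD iD.
exact: subset_trans (sB i) (bigcup_sup i iD).
Qed.

Definition disjoint_family D B : Prop :=
  {in D &, forall i j, i != j -> [disjoint B i & B j]}.

Lemma disjoint_familyS D D' B B' :
    D' \subset D -> (forall i, B' i \subset B i) ->
  disjoint_family D B -> disjoint_family D' B'.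
Proof.
move=> /subsetP sD sB disB i j /sD iD /sD jD neq_ij.
exact: disjointW (sB i) (sB j) (disB i j iD jD neq_ij).
Qed.

Lemma disjoint_family_meets_at_most_one D B (N : {set V}) (i0 : I) :
    disjoint_family D B -> #|N :&: \bigcup_(i in D) B i| <= 1 ->
  exists r, {in D, forall i, i != r -> [disjoint B i & N]}.
Proof.
move=> disB /card_le1_eqP N1.
have [r /andP[rD meet_r] | none] :=
    pickP [pred i | (i \in D) && ~~ [disjoint B i & N]]; last first.
  by exists i0 => i iD _; move: (none i); rewrite /= iD => /negbFE.
exists r => i iD; apply: contraR => /pred0Pn[u /= /andP[uB uN]].
have /pred0Pn[w /= /andP[wB wN]] := meet_r.
apply: contraT => neq_ir.
suff eq_uw : u = w.
  by have := disjointFr (disB i r iD rD neq_ir) uB; rewrite eq_uw wB.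
by apply: N1; rewrite inE ?uN ?wN; apply/bigcupP; [exists r | exists i].
Qed.

End SetFamilies.

Section Neighbourhoods.

Variables (V : finType) (e : rel V).
Hypotheses (e_sym : symmetric e) (e_irr : irreflexive e).
Implicit Types (A X : {set V}) (u v : V).

Definition nbhds A : {set V} := \bigcup_(a in A) nbhd e a.

Lemma nbhdsP A v : reflect (exists2 a, a \in A & e a v) (v \in nbhds A).
Proof.
apply: (iffP bigcupP) => -[a aA av]; exists a => //; last by rewrite inE.
by rewrite inE in av.
Qed.

Lemma nbhdsS A X : A \subset X -> nbhds A \subset nbhds X.
Proof. by move=> sAX; apply: bigcupSS. Qed.

Lemma nbhds_card_gt0 A v : (v \in nbhds A) = (0 < #|nbhd e v :&: A|).
Proof.
apply/nbhdsP/card_gt0P => [[a aA eav] | [a /setIP[va aA]]]; exists a => //.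
  by rewrite !inE e_sym eav.
by rewrite inE e_sym in va.
Qed.

Definition dominates X A : bool := X \subset A :|: nbhds A.

Lemma dominatesS X A A' : A \subset A' -> dominates X A -> dominates X A'.
Proof.
move=> sAA' domA; apply: subset_trans domA _.
exact: setUSS sAA' (nbhdsS sAA').
Qed.

Lemma dominates_setT A : dominates setT A -> dominating e A.
Proof.
move=> /subsetP domA; apply/forallP => v.
have /setUP[-> // | /nbhdsP[a aA eav]] := domA v (in_setT v).
by apply/orP; right; apply/exists_inP; exists a; rewrite // e_sym.
Qed.

Lemma independentP A :
  reflect {in A &, forall u v, ~~ e u v} (independent e A).
Proof.
apply: (iffP forall_inP) => [indA u v uA | indA u uA].
  by move: v; apply/forall_inP/indA.
by apply/forall_inP => v; apply: indA.
Qed.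

Lemma independentE A : independent e A = [disjoint A & nbhds A].
Proof.
apply/independentP/pred0P => [indA v | disA u v uA vA].
  by apply/negP => /= /andP[vA /nbhdsP[u uA]]; apply/negP/indA.
by apply/negP => euv; have /= := disA v; rewrite vA => /nbhdsP[]; exists u.
Qed.

Lemma independent_disjoint_nbhd A v :
  independent e A -> v \in A -> [disjoint A & nbhd e v].
Proof. by rewrite independentE => disA /bigcup_sup/disjointWr; apply. Qed.

Lemma independent0 : independent e set0.
Proof. by apply/independentP => u v; rewrite inE. Qed.

Lemma independentU1 A v :
  independent e A -> v \notin nbhds A -> independent e (v |: A).
Proof.
move=> /independentP indA /nbhdsP vA; have nev u : u \in A -> ~~ e u v.
  by move=> uA; apply/negP => euv; apply: vA; exists u.
apply/independentP => u w /setU1P[-> | uA] /setU1P[-> | wA].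
- by rewrite e_irr.
- by rewrite e_sym nev.
- exact: nev.
- exact: indA.
Qed.

Definition maximal_independent_in X A : bool :=
  maxset (fun I : {set V} => independent e I && (I \subset X)) A.

Lemma maximal_independent_in_dominates X A :
  maximal_independent_in X A -> dominates X A.
Proof.
move=> /maxsetP[/andP[indA sAX] maxA]; apply/subsetP => v vX.
rewrite inE; apply: contraT; rewrite negb_or => /andP[/negP vA vnA].
case: vA; rewrite -(maxA (v |: A)) ?setU11 ?subsetUr //.
by rewrite independentU1 // subUset sub1set vX.
Qed.

Lemma independent_extends_in X A :
    independent e A -> A \subset X ->
  exists I, [/\ independent e I, A \subset I, I \subset X & dominates X I].
Proof.
move=> indA sAX.
have [|I maxI sAI] :=
    @maxset_exists _ (fun I : {set V} => independent e I && (I \subset X)) A.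
  by rewrite indA.
have /andP[indI sIX] := maxsetp maxI.
by exists I; split=> //; apply: maximal_independent_in_dominates.
Qed.

End Neighbourhoods.

Section Transversal.

Variables (V I : finType) (e : rel V).
Hypotheses (e_sym : symmetric e) (e_irr : irreflexive e).
Implicit Types (D : {set I}) (B : I -> {set V}) (T Y : {set V}).

Definition induces_matching Y : Prop :=
  {in Y, forall v, #|nbhd e v :&: Y| <= 1}.

Lemma induces_matchingS Y Y' :
  Y' \subset Y -> induces_matching Y -> induces_matching Y'.
Proof.
move=> sY matchY v /(subsetP sY)/matchY; apply: leq_trans.
exact/subset_leq_card/setIS.
Qed.

Definition independent_transversal D B T : Prop :=
  [/\ independent e T, T \subset \bigcup_(i in D) B i &
      {in D, forall i, ~~ [disjoint T & B i]}].

Lemma independent_transversal0 B : independent_transversal set0 B set0.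
Proof. by split=> [||i]; rewrite ?independent0 ?sub0set ?inE. Qed.

Lemma independent_transversalU1 D B T r a :
    r \in D -> a \in B r ->
    independent_transversal (D :\ r) (fun i => B i :\: nbhd e a) T ->
  independent_transversal D B (a |: T).
Proof.
move=> rD aB [indT sT hitT]; split.
- apply: independentU1 => //; apply/nbhdsP => -[u /(subsetP sT)].
  by case/bigcupP => i _; rewrite !inE e_sym => /andP[/negP].
- rewrite subUset sub1set; apply/andP; split; first by apply/bigcupP; exists r.
  by apply: subset_trans sT _; apply: bigcupSS => [|i]; apply: subsetDl.
- move=> i iD; have [-> | neq_ir] := eqVneq i r.
    by apply/pred0Pn; exists a; rewrite /= setU11.
  have iD' : i \in D :\ r by rewrite in_setD1 neq_ir.
  apply: contra (hitT i iD').
  by apply: disjointW; [apply: subsetUr | apply: subsetDl].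
Qed.

(* Allowing one class to be a singleton makes the induction work: a vertex of
   that class has at most one neighbour in the other classes, and deleting this
   neighbour shrinks only one of them. *)
Lemma exists_independent_transversal_but_one D B (r : I) :
    disjoint_family D B -> induces_matching (\bigcup_(i in D) B i) ->
    {in D, forall i, (i != r) < #|B i|} ->
  exists T, independent_transversal D B T.
Proof.
have [n] := ubnP #|D|; elim: n => // n IHn in D B r *.
move=> ltDn disB matchB cardB; have [-> | [r1 r1D]] := set_0Vmem D.
  by exists set0; apply: independent_transversal0.
wlog rD : r cardB / r \in D.
  move=> hwlog; have [|rD] := boolP (r \in D); first exact: hwlog.
  apply: (hwlog r1) => // i iD; apply: leq_ltn_trans (leq_b1 _) _.
  by have := cardB i iD; case: eqP rD => // <-; rewrite iD.
have /card_gt0P[a aB] : 0 < #|B r| by apply: leq_trans (cardB r rD).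
have disB' : disjoint_family (D :\ r) B.
  by apply: disjoint_familyS disB => //; apply: subsetDl.
have Na1 : #|nbhd e a :&: \bigcup_(i in D :\ r) B i| <= 1.
  have aU : a \in \bigcup_(i in D) B i by apply/bigcupP; exists r.
  apply: leq_trans (subset_leq_card _) (matchB a aU); apply: setIS.
  by apply: bigcupSS => //; apply: subsetDl.
have [r' avoid_r'] := disjoint_family_meets_at_most_one r disB' Na1.
have [|||| T trT] := IHn (D :\ r) (fun i => B i :\: nbhd e a) r'.
- by move: ltDn; rewrite (cardsD1 r) rD.
- by apply: disjoint_familyS disB' => // i; apply: subsetDl.
- apply: induces_matchingS matchB.
  by apply: bigcupSS => [|i]; apply: subsetDl.
- move=> i iD'; have /setD1P[neq_ir iD] := iD'.
  have B2 : 1 < #|B i| by have := cardB i iD; rewrite neq_ir.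
  have [_ | neq_ir'] := eqVneq i r'; last by rewrite (setDidPl _) ?avoid_r'.
  rewrite cardsD subn_gt0; apply: leq_ltn_trans B2.
  apply: leq_trans (subset_leq_card _) Na1.
  by rewrite setIC; apply/setIS/bigcup_sup.
by exists (a |: T); apply: independent_transversalU1 trT.
Qed.

Lemma exists_independent_transversal D B :
    disjoint_family D B -> induces_matching (\bigcup_(i in D) B i) ->
    {in D, forall i, 1 < #|B i|} ->
  exists T, independent_transversal D B T.
Proof.
have [-> | [r rD]] := set_0Vmem D.
  by exists set0; apply: independent_transversal0.
move=> disB matchB cardB.
apply: (exists_independent_transversal_but_one (r := r)) => //.
by move=> i iD; apply: leq_ltn_trans (leq_b1 _) (cardB i iD).
Qed.

End Transversal.

Section Regions.

Variables (V : finType) (e : rel V) (S : {set V}).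
Hypotheses (e_sym : symmetric e) (e_irr : irreflexive e).
Implicit Types (A : {set V}) (s v x : V).

Definition square : rel V :=
  [rel u v | (u != v) && ~~ [disjoint cl_nbhd e u & cl_nbhd e v]].

Lemma square_sym : symmetric square.
Proof. by move=> u v; rewrite /square /= eq_sym disjoint_sym. Qed.

Lemma square_irr : irreflexive square.
Proof. by move=> v; rewrite /square /= eqxx. Qed.

Lemma packing_square A : packing e A = independent square A.
Proof.
apply: eq_forallb_in => u _; apply: eq_forallb_in => v _.
by rewrite /= implybE negb_and !negbK.
Qed.

Lemma maximal_packing_square A :
  maximal_packing e A = maximal_independent_in square setT A.
Proof. by apply: maxset_eq => B; rewrite packing_square subsetT andbT. Qed.

Lemma packing_disjoint_nbhd : packing e S -> disjoint_family S (nbhd e).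
Proof.
move=> /forall_inP pS s t sS tS neq_st.
have /forall_inP/(_ t tS)/implyP/(_ neq_st) := pS s sS.
by apply: disjointW; apply: subsetUr.
Qed.

Lemma packing_independent : packing e S -> independent e S.
Proof.
rewrite packing_square => /independentP pS; apply/independentP => s t sS tS.
apply: contra (pS s t sS tS) => est /=; apply/andP; split.
  by apply: contraTneq est => ->; rewrite e_irr.
by apply/pred0Pn; exists t; rewrite /= !inE est eqxx orbT.
Qed.

Definition remote : {set V} := ~: (S :|: nbhds e S).

Definition star x : {set V} := x |: (nbhd e x :&: remote).

Definition region s : {set V} := s |: \bigcup_(x in nbhd e s) star x.

Definition frontier s : {set V} := nbhd e s :&: nbhds e remote.

Definition hits_large_frontiers A : Prop :=
  {in S, forall s, 1 < #|frontier s| -> ~~ [disjoint A & nbhd e s]}.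

Lemma hits_large_frontiersS A A' :
  A \subset A' -> hits_large_frontiers A -> hits_large_frontiers A'.
Proof.
by move=> sAA' hitA s sS /(hitA s sS); apply/contra/disjointWl.
Qed.

Lemma maximal_packing_remote :
  maximal_packing e S -> remote \subset nbhds e (nbhds e S).
Proof.
move=> maxS; apply/subsetP => v; rewrite !inE negb_or => /andP[vS vnS].
rewrite maximal_packing_square in maxS.
have := maximal_independent_in_dominates square_sym square_irr maxS.
move=> /subsetP/(_ v (in_setT v)).
rewrite inE (negPf vS) => /nbhdsP[s sS /andP[_ /pred0Pn[w /andP[]]]].
rewrite !inE => /predU1P[-> | esw] /predU1P[vw | evw].
- by rewrite -vw sS in vS.
- by case/nbhdsP: vnS; exists s; rewrite // e_sym.
- by case/nbhdsP: vnS; exists s; rewrite // -vw.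
- by apply/nbhdsP; exists w; rewrite 1?e_sym //; apply/nbhdsP; exists s.
Qed.

Lemma maximal_packing_regions :
  maximal_packing e S -> \bigcup_(s in S) region s = [set: V].
Proof.
move=> maxS; apply/eqP; rewrite -subTset; apply/subsetP => v _.
have star_cover x :
    x \in nbhds e S -> v \in star x -> v \in \bigcup_(s in S) region s.
  move=> /bigcupP[s sS xs] vx; apply/bigcupP; exists s => //.
  by apply/setU1P; right; apply/bigcupP; exists x.
have [vS | vS] := boolP (v \in S).
  by apply/bigcupP; exists v; rewrite ?setU11.
have [vX | vX] := boolP (v \in nbhds e S).
  exact: star_cover vX (setU11 _ _).
have vR : v \in remote by rewrite !inE negb_or vS.
have /nbhdsP[x xX exv] := subsetP (maximal_packing_remote maxS) v vR.
by apply: star_cover xX _; apply/setU1P; right; rewrite in_setI vR inE exv.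
Qed.

Lemma card_nbhds_remote_lt_degree x :
    independent e S -> x \in nbhds e S ->
  #|nbhd e x :&: nbhds e S| + #|nbhd e x :&: remote| < degree e x.
Proof.
rewrite independentE nbhds_card_gt0 // disjoint_sym => /setDidPl XS xS.
rewrite /degree -(cardsID S (nbhd e x)) -(cardsID (nbhds e S) (nbhd e x :\: S)).
rewrite setDDl [_ :\: (_ :|: _)]setDE -/remote setIDAC -setIDA XS.
by rewrite -[ltnLHS]add0n ltn_add2r.
Qed.

Section Subcubic.

Hypothesis deg3 : forall v, degree e v <= 3.

Lemma card_nbhds_remote_leq2 x :
    independent e S -> x \in nbhds e S ->
  #|nbhd e x :&: nbhds e S| + #|nbhd e x :&: remote| <= 2.
Proof.
move=> indS xX.
exact: leq_trans (card_nbhds_remote_lt_degree indS xX) (deg3 x).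
Qed.

Lemma frontier_induces_matching (F : {set V}) :
    independent e S -> F \subset S ->
  induces_matching e (\bigcup_(s in F) frontier s).
Proof.
move=> indS sFS; apply: (@induces_matchingS _ _ (nbhds e S :&: nbhds e remote)).
  by apply/bigcupsP => s /(subsetP sFS) sS; apply: setSI; apply: bigcup_sup.
move=> x /setIP[xX]; rewrite nbhds_card_gt0 // => xR.
apply: leq_trans (subset_leq_card (setIS _ (subsetIl _ _))) _.
rewrite -ltnS -addn1; apply: leq_trans (leq_add (leqnn _) xR) _.
exact: card_nbhds_remote_leq2.
Qed.

Section IndependentSet.

Variable A : {set V}.
Hypotheses (indS : independent e S) (indA : independent e A).
Hypothesis domA : dominates e (nbhds e S) (A :&: nbhds e S).

Lemma independent_star x : x \in A -> A :&: star x = [set x].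
Proof.
move=> xA; apply/setP => v; rewrite !inE.
have [-> | _] := eqVneq v x; first by rewrite xA.
apply: contraTF isT => /and3P[vA xv _].
by have /independentP/(_ x v xA vA)/negP := indA.
Qed.

Lemma card_independent_star x : x \in nbhds e S -> #|A :&: star x| <= 1.
Proof.
move=> xX; have [xA | xA] := boolP (x \in A).
  by rewrite independent_star ?cards1.
have /setUP[|] := subsetP domA x xX; first by rewrite inE (negPf xA).
rewrite nbhds_card_gt0 // => xX'.
have sub_star : A :&: star x \subset nbhd e x :&: remote.
  apply/subsetP => v; rewrite inE => /andP[vA /setU1P[vx | //]].
  by rewrite -vx vA in xA.
apply: leq_trans (subset_leq_card sub_star) _.
rewrite -ltnS; apply: leq_trans (leq_add xX' (leqnn _)) _.
apply: leq_trans (card_nbhds_remote_leq2 indS xX); rewrite leq_add2r.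
exact/subset_leq_card/setIS/subsetIr.
Qed.

Lemma card_independent_stars s (P : {set V}) :
  s \in S -> P \subset nbhd e s -> #|A :&: \bigcup_(x in P) star x| <= #|P|.
Proof.
move=> sS /subsetP sP; rewrite big_distrr -[leqRHS]sum1_card /=.
apply: leq_trans (leq_card_bigcup _ _) _; apply: leq_sum => x /sP xs.
by apply/card_independent_star/(subsetP (bigcup_sup s sS)).
Qed.

Lemma independent_stars_frontier s :
    s \in A ->
  A :&: \bigcup_(x in nbhd e s) star x \subset \bigcup_(x in frontier s) star x.
Proof.
move=> sA; apply/subsetP => v /setIP[vA /bigcupP[x xs vx]].
apply/bigcupP; exists x => //; rewrite inE xs; apply/nbhdsP.
case/setU1P: vx => [vx | /setIP[]]; last by rewrite inE e_sym; exists v.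
by rewrite -vx (disjointFr (independent_disjoint_nbhd indA sA) vA) in xs.
Qed.

Lemma card_independent_region s :
    s \in S -> (1 < #|frontier s| -> ~~ [disjoint A & nbhd e s]) ->
  #|A :&: region s| <= 3.
Proof.
move=> sS hitA; rewrite /region setIUr.
have [sA | sA] := boolP (s \in A); last first.
  rewrite (disjoint_setI0 _) ?set0U; last by rewrite disjoint_sym disjoints1.
  exact: leq_trans (card_independent_stars sS (subxx _)) (deg3 s).
have frontier1 : #|frontier s| <= 1.
  by rewrite leqNgt; apply/negP => /hitA; rewrite independent_disjoint_nbhd.
have sub_frontier : A :&: \bigcup_(x in nbhd e s) star x
    \subset A :&: \bigcup_(x in frontier s) star x.
  by rewrite subsetI subsetIl independent_stars_frontier.
apply: leq_trans (leq_card_setU _ _) _.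
rewrite (leq_add (n1 := 1) (n2 := 2)) //.
  by rewrite -(cards1 s) subset_leq_card ?subsetIr.
apply: leq_trans (subset_leq_card sub_frontier) _.
exact: leq_trans (card_independent_stars sS (subsetIl _ _)) (leqW frontier1).
Qed.

End IndependentSet.

Lemma card_independent_hits_large_frontiers A :
    maximal_packing e S -> independent e A ->
    dominates e (nbhds e S) (A :&: nbhds e S) ->
    hits_large_frontiers A ->
  #|A| <= 3 * #|S|.
Proof.
move=> maxS indA domA hitA; have indS := packing_independent (maxsetp maxS).
rewrite -[A]setIT -(maximal_packing_regions maxS) big_distrr /=.
apply: leq_trans (leq_card_bigcup _ _) _; rewrite mulnC -sum_nat_const.
by apply: leq_sum => s sS; apply: card_independent_region (hitA s sS).
Qed.

Lemma exists_independent_hits_large_frontiers :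
  packing e S ->
  exists T, [/\ independent e T, T \subset nbhds e S & hits_large_frontiers T].
Proof.
move=> pS; pose F := [set s in S | 1 < #|frontier s|].
have sFS : F \subset S by apply/subsetP => s /setIdP[].
have [|||T [indT sT hitT]] :=
    @exists_independent_transversal _ _ _ e_sym e_irr F frontier.
- apply: disjoint_familyS (packing_disjoint_nbhd pS) => // s.
  exact: subsetIl.
- exact/frontier_induces_matching/sFS/packing_independent.
- by move=> s /setIdP[].
exists T; split=> // [|s sS front2].
  by apply: subset_trans sT _; apply: bigcupSS => // s; apply: subsetIl.
have sF : s \in F by apply/setIdP.
by apply: contra (hitT s sF); apply/disjointWr/subsetIl.
Qed.

End Subcubic.

End Regions.

Theorem theorem1 (V : finType) (e : rel V) (S : {set V}) :
  simple_graph e ->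
  (forall v : V, degree e v <= 3) ->
  maximal_packing e S ->
  exists A : {set V},
    [/\ independent e A, dominating e A & #|A| <= 3 * #|S|].
Proof.
move=> [e_sym e_irr] deg3 maxS.
have [T [indT sTX hitT]] :=
  exists_independent_hits_large_frontiers e_sym e_irr deg3 (maxsetp maxS).
have [I [indI sTI sIX domI]] := independent_extends_in e_sym e_irr indT sTX.
have [A [indA sIA _ domA]] :=
  independent_extends_in e_sym e_irr indI (subsetT I).
exists A; split=> //; first exact: dominates_setT.
apply: card_independent_hits_large_frontiers => //.
  by apply: dominatesS domI; rewrite subsetI sIA.
exact: hits_large_frontiersS (subset_trans sTI sIA) hitT.
Qed.
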